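(* Let $K$ be a field, $V$ a vector space over $K$, $A: V \to V$ a $K$-linear operator, $B = [b_{ij}]_{i,j=1}^n \in K^{n\times n}$ and $\vec{\varphi} = [\varphi_1 \ \ldots\ \varphi_n]^T \in V^{n\times 1}$. Consider the linear system of first order $A$-operator equations in the unknowns $x_1,\ldots,x_n \in V$ $$A(x_i) = b_{i1}x_1 + b_{i2}x_2 + \ldots + b_{in}x_n + \varphi_i, \qquad 1 \le i \le n.$$ This system implies the following system of $n$th order $A$-operator equations: every solution $(x_1,\ldots,x_n)$ of it satisfies $$\big(\Delta_B(A)\big)(x_i) = \sum_{k=1}^{n} (-1)^{k-1}\, \delta_k^i\big(B; \vec{A}^{\,n-k}(\vec{\varphi})\big), \qquad 1 \le i \le n.$$
   Context: $\Delta_B(\lambda) = \det(\lambda I - B) = \lambda^n + d_1\lambda^{n-1} + \ldots + d_{n-1}\lambda + d_n$ is the characteristic polynomial of $B$, and $\Delta_B(A) = A^n + d_1 A^{n-1} + \ldots + d_{n-1} A + d_n I$, where $A^0 = I$ is the identity operator on $V$ and $A^i = A^{i-1}\circ A$. $\vec{A}: V^{n\times 1}\to V^{n\times 1}$ is defined componentwise by $\vec{A}([x_1\ \ldots\ x_n]^T) = [A(x_1)\ \ldots\ A(x_n)]^T$, so that $\vec{A}^{\,m}(\vec{\varphi}) = [A^m(\varphi_1)\ \ldots\ A^m(\varphi_n)]^T$. For a square matrix $M$ of order $n$ and $1\le i,k\le n$, $\delta_k^i(M)$ denotes the sum of the principal minors of $M$ of order $k$ containing the $i$th column. For a column $\vec{v}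 = [v_1\ \ldots\ v_n]^T$, $B^i(v_1,\ldots,v_n)$ is the matrix obtained from $B$ by substituting $\vec{v}$ in place of the $i$th column, and $\delta_k^i(B;\vec{v}) = \delta_k^i(B^i(v_1,\ldots,v_n))$. When $\vec v\in V^{n\times 1}$, each minor involved has exactly one column with entries in $V$ and the others in $K$, and it is understood as the element of $V$ obtained by expanding along that column; equivalently, $\delta_k^i(B;\vec{v}) = \sum_{s=1}^n \delta_k^i(B;\vec{e}_s)\, v_s$, where $\vec{e}_s \in K^{n\times 1}$ is the $s$th standard basis column. *)

(* Defs.v *)
From HB Require Import structures.
From mathcomp Require Import all_boot all_order all_algebra.
Set Implicit Arguments.
Unset Strict Implicit.
Unset Printing Implicit Defensive.
Import GRing.Theory.
Local Open Scope ring_scope.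

Definition horner_op (K : fieldType) (V : lmodType K) (p : {poly K})
    (A : V -> V) (x : V) : V :=
  \sum_(m < size p) p`_m *: iter m A x.

Definition principal_submx (R : Type) (n : nat) (S : {set 'I_n})
    (M : 'M[R]_n) : 'M[R]_#|S| :=
  mxsub (@enum_val _ (mem S)) (@enum_val _ (mem S)) M.

Definition delta_minors (K : fieldType) (n k : nat) (i : 'I_n)
    (M : 'M[K]_n) : K :=
  \sum_(S : {set 'I_n} | (i \in S) && (#|S| == k)) \det (principal_submx S M).

Definition subst_col (R : Type) (n : nat) (B : 'M[R]_n) (i : 'I_n)
    (v : 'cV[R]_n) : 'M[R]_n :=
  \matrix_(r, c) (if c == i then v r 0 else B r c).

(* The determinant, expanded along column j, of the matrix obtained from M by
   substituting v for column j; cofactor M r j ignores column j of M. *)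
Definition det_vcol (K : fieldType) (V : lmodType K) (m : nat) (M : 'M[K]_m)
    (j : 'I_m) (v : 'cV[V]_m) : V :=
  \sum_r cofactor M r j *: v r 0.

(* enum_rank_in (valP S) i is the position of i in the increasing enumeration
   of S, i.e. the column of the minor that carries the entries of v. *)
Definition delta_minors_vec (K : fieldType) (V : lmodType K) (n k : nat)
    (i : 'I_n) (B : 'M[K]_n) (v : 'cV[V]_n) : V :=
  \sum_(S : {S : {set 'I_n} | i \in S} | #|val S| == k)
    det_vcol (principal_submx (val S) B) (enum_rank_in (valP S) i)
             (rowsub (@enum_val _ (mem (val S))) v).

Lemma det_subst_col (K : fieldType) (m : nat) (M : 'M[K]_m) (j : 'I_m)
    (v : 'cV[K]_m) :
  \det (subst_col M j v) = \sum_r cofactor M r j * v r 0.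
Proof.
rewrite (expand_det_col _ j); apply: eq_bigr => r _.
rewrite mxE eqxx mulrC; congr (_ * _).
rewrite /cofactor; congr (_ * \det _).
by apply/matrixP => a b; rewrite !mxE eq_sym (negPf (neq_lift _ _)).
Qed.

Lemma principal_submx_subst_col (R : Type) (n : nat) (S : {set 'I_n})
    (B : 'M[R]_n) (i : 'I_n) (iS : i \in S) (v : 'cV[R]_n) :
  principal_submx S (subst_col B i v) =
  subst_col (principal_submx S B) (enum_rank_in iS i)
            (rowsub (@enum_val _ (mem S)) v).
Proof.
apply/matrixP => r c; rewrite !mxE.
have -> : (enum_val c == i) = (c == enum_rank_in iS i); last by [].
by rewrite -[in LHS](enum_rankK_in iS iS) (inj_eq enum_val_inj).
Qed.

Lemma delta_minors_vecE (K : fieldType) (V : lmodType K) (n k : nat)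
    (i : 'I_n) (B : 'M[K]_n) (v : 'cV[V]_n) :
  delta_minors_vec k i B v =
  \sum_s delta_minors k i (subst_col B i (delta_mx s 0)) *: v s 0.
Proof.
under [RHS]eq_bigr => s _ do rewrite /delta_minors scaler_suml.
rewrite exchange_big /=.
rewrite (big_sub_cond [pred S : {set 'I_n} | i \in S]) /=.
apply: eq_bigr => S _; rewrite /det_vcol.
under [RHS]eq_bigr => s _
  do rewrite (principal_submx_subst_col B (valP S)) det_subst_col
             scaler_suml.
rewrite exchange_big /=; apply: eq_bigr => r _.
rewrite (bigD1 (enum_val r)) //= big1 ?addr0 => [|s ne_s].
  by rewrite !mxE !eqxx mulr1.
by rewrite !mxE eq_sym (negPf ne_s) mulr0 scale0r.
Qed.

(* Main.v *)
Require Import Defs.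
From HB Require Import structures.
From mathcomp Require Import perm.
From mathcomp Require Import all_boot all_order all_algebra.
Set Implicit Arguments.
Unset Strict Implicit.
Unset Printing Implicit Defensive.
Import GRing.Theory.
Local Open Scope ring_scope.

(** Letting ['X] act on [V] as [A] makes [V] a module over [{poly K}]
    ([horner_opM]), and the first order system becomes the single matrix
    equation ('X I - B) x = phi over that module.  Multiplying it by the
    adjugate of ['X I - B] uncouples the unknowns: the characteristic
    polynomial of [B], applied to [A], sends [x_i] to the sum over [s] of the
    [(s, i)] cofactors of ['X I - B] acting on [phi_s]
    ([char_poly_op_solution]).

    What remains is to read off the coefficients of these cofactors
    ([cofactor_char_poly_mx]).  Such a cofactor is the determinant of
    ['X I - B] with its [i]-th column replaced by a standard basis column.
    This matrix is a diagonal matrix plus a constant one, so its determinant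
    expands into principal minors of the constant matrix ([det_diagD]); the
    diagonal matrix has a zero at [i] and ['X] elsewhere, so that the surviving
    minors are those containing [i], and one of order [k] comes with
    ['X ^+ (n - k)].  The sign [(-1) ^+ k.-1] comes from the [k - 1] columns
    of such a minor that are taken from [- B]. *)

(** * Determinant of a diagonal matrix plus an arbitrary one *)

(** Equal cardinality forces [m = n]; the reindexing is then a permutation,
    applied to the rows and to the columns, so that its signs cancel. *)
Lemma det_mxsub_bij (R : comNzRingType) (m n : nat) (f : 'I_m -> 'I_n)
    (M : 'M[R]_n) : bijective f -> \det (mxsub f f M) = \det M.
Proof.
move=> bij_f; have mn : m = n.
  by rewrite -(card_ord m) -(card_ord n); exact: bij_eq_card bij_f.
case: n / mn f M bij_f => f M bij_f.
pose s := perm (bij_inj bij_f).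
have -> : mxsub f f M = row_perm s (col_perm s M).
  by apply/matrixP => i j; rewrite !mxE !permE.
rewrite row_permE col_permE !det_mulmx !det_perm odd_permV mulrCA.
by rewrite -signr_addb addbb mulr1.
Qed.

(** Listing the indices of [S] first makes the matrix block upper triangular,
    with diagonal blocks the principal submatrix on [S] and a diagonal one. *)
Lemma det_diag_rows_outside (R : comNzRingType) (n : nat) (S : {set 'I_n})
    (d : 'I_n -> R) (M : 'M[R]_n) :
  \det (\matrix_(r, c) (if r \in S then M r c else d r *+ (r == c))) =
  (\prod_(j in ~: S) d j) * \det (principal_submx S M).
Proof.
pose f (k : 'I_(#|S| + #|~: S|)) : 'I_n :=
  match split k with inl a => enum_val a | inr b => enum_val b end.
have inS (a : 'I_#|S|) : enum_val a \in S by exact: enum_valP.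
have notinS (b : 'I_#|~: S|) : (enum_val b \in S) = false.
  by have := enum_valP b; rewrite inE => /negPf.
have inj_f : injective f.
  move=> k l; rewrite /f -[k]splitK -[l]splitK !unsplitK.
  case: (split k) => a; case: (split l) => b /= e.
  - by rewrite (enum_val_inj e).
  - by have := notinS b; rewrite -e inS.
  - by have := notinS a; rewrite e inS.
  - by rewrite (enum_val_inj e).
have bij_f : bijective f.
  by apply: inj_card_bij inj_f _; rewrite !card_ord cardsC card_ord.
set N := (X in \det X); rewrite -(det_mxsub_bij N bij_f).
have -> : mxsub f f N =
  block_mx (principal_submx S M)
           (\matrix_(a, b) M (enum_val a) (enum_val b)) 0
           (diag_mx (\row_(b < #|~: S|) d (enum_val b))).
  apply/matrixP => k l; rewrite -[k]splitK -[l]splitK mxE.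
  rewrite /f !unsplitK.
  case: (split k) => a; case: (split l) => b /=.
  - by rewrite block_mxEul !mxE inS.
  - by rewrite block_mxEur !mxE inS.
  - rewrite block_mxEdl !mxE notinS; case: eqP => // e.
    by have := notinS a; rewrite e inS.
  - by rewrite block_mxEdr !mxE notinS (inj_eq enum_val_inj); case: (a == b).
rewrite det_ublock det_diag mulrC; congr (_ * _).
by rewrite [RHS]big_enum_val; apply: eq_bigr => b _; rewrite mxE.
Qed.

(** Row multilinearity: each row of the sum is either the row of [M] or the
    diagonal one, and [S] collects the rows where [M] is taken. *)
Lemma det_diagD (R : comNzRingType) (n : nat) (d : 'I_n -> R) (M : 'M[R]_n) :
  \det (diag_mx (\row_j d j) + M) =
  \sum_(S : {set 'I_n})
    (\prod_(j in ~: S) d j) * \det (principal_submx S M).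
Proof.
under [RHS]eq_bigr => S _ do rewrite -det_diag_rows_outside /determinant.
rewrite exchange_big /=; apply: eq_bigr => s _.
rewrite -big_distrr /=; congr (_ * _).
under eq_bigr => i _ do rewrite addrC.
under eq_bigr => i _ do rewrite !mxE.
rewrite bigA_distr /=; apply: eq_bigr => S _.
by apply: eq_bigr => i _; rewrite mxE.
Qed.

(** * Cofactors of the characteristic matrix *)

Lemma det_opp (R : comNzRingType) (m : nat) (M : 'M[R]_m) :
  \det (- M) = (-1) ^+ m * \det M.
Proof. by rewrite -scaleN1r detZ. Qed.

(** Column [i] is replaced by [v] on both sides, so that negating [B] affects
    the other [#|S|.-1] columns only. *)
Lemma det_principal_subst_col_opp (K : fieldType) (n : nat) (S : {set 'I_n})
    (B : 'M[K]_n) (i : 'I_n) (v : 'cV[K]_n) : i \in S ->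
  \det (principal_submx S (subst_col (- B) i v)) =
  (-1) ^+ #|S|.-1 * \det (principal_submx S (subst_col B i v)).
Proof.
move=> iS; rewrite !(principal_submx_subst_col _ iS) !det_subst_col mulr_sumr.
apply: eq_bigr => r _; rewrite mulrA; congr (_ * _).
rewrite /cofactor mulrCA -det_opp; congr (_ * \det _).
by apply/matrixP => a b; rewrite !mxE.
Qed.

(** A cofactor along column [i] is the determinant with a standard basis column
    in place of column [i].  That matrix is a constant matrix plus a diagonal
    one with ['X] on the diagonal, except for a zero at [i]: hence only the
    minors containing [i] survive. *)
Lemma cofactor_char_poly_mx (K : fieldType) (n : nat) (B : 'M[K]_n)
    (s i : 'I_n) :
  cofactor (char_poly_mx B) s i =
  \sum_(1 <= k < n.+1)
    ((-1) ^+ k.-1 * delta_minors k i (subst_col B i (delta_mx s 0))) *: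
      'X^(n - k).
Proof.
pose C := subst_col (- B) i (delta_mx s 0).
pose d (j : 'I_n) : {poly K} := if j == i then 0 else 'X.
have -> : cofactor (char_poly_mx B) s i =
          \det (diag_mx (\row_j d j) + map_mx polyC C).
  rewrite (expand_det_col _ i) (bigD1 s) //= big1 ?addr0 => [|r ne_r].
    rewrite !mxE !eqxx /d /=.
    have -> : (if s == i then 0 : {poly K} else 'X) *+ (s == i) = 0.
      by case: (s == i).
    rewrite add0r mul1r /cofactor; congr (_ * \det _).
    apply/matrixP => a b; rewrite !mxE /d.
    have ne_i : (lift i b == i) = false.
      by rewrite eq_sym (negPf (neq_lift i b)).
    by rewrite ne_i polyCN; case: eqP => // ->; rewrite ne_i.
  rewrite !mxE !eqxx /d (negPf ne_r).
  by case: (r == i); rewrite /= ?mulr0n ?addr0 mul0r.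
rewrite det_diagD (bigID (fun S : {set 'I_n} => i \in S)) /=.
rewrite [X in _ + X]big1 ?addr0 => [|S iS]; last first.
  by rewrite (bigD1 i) ?inE //= /d eqxx !mul0r.
have termE (S : {set 'I_n}) : i \in S ->
    (\prod_(j in ~: S) d j) * \det (principal_submx S (map_mx polyC C)) =
    ((-1) ^+ #|S|.-1 *
       \det (principal_submx S (subst_col B i (delta_mx s 0)))) *:
      'X^(n - #|S|).
  move=> iS; rewrite -det_principal_subst_col_opp // -mul_polyC mulrC.
  congr (_ * _).
    by rewrite -det_map_mx; congr (\det _); apply/matrixP => a b; rewrite !mxE.
  rewrite (eq_bigr (fun=> 'X)) => [|j].
    by rewrite prodr_const cardsCs setCK card_ord.
  by rewrite inE /d; case: eqP => // ->; rewrite iS.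
rewrite (eq_bigr _ termE) big_add1 /= big_mkord.
(* The sets contain i, so #|S|.-1 is an index below n: it serves to group the
   sets by cardinality, the default value of insubd never being reached. *)
have cardS (S : {set 'I_n}) : i \in S -> (#|S|.-1 < n)%N.
  move=> iS; have := max_card (mem S); rewrite card_ord.
  by rewrite (cardD1 i) iS.
pose h (S : {set 'I_n}) : 'I_n := insubd i #|S|.-1.
rewrite (partition_big h predT) //=; apply: eq_bigr => k _.
rewrite /delta_minors mulr_sumr scaler_suml.
have cond (S : {set 'I_n}) :
    (i \in S) && (h S == k) = (i \in S) && (#|S| == k.+1).
  case iS: (i \in S) => //=; rewrite -val_eqE /= val_insubd cardS //.
  by have := iS; rewrite (cardD1 i) iS.
rewrite (eq_bigl _ _ cond); apply: eq_bigr => S /andP[_ /eqP cS].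
by congr ((_ ^+ _ * _) *: 'X^(_ - _)); rewrite cS.
Qed.

(** * Polynomials in an operator *)

Section HornerOp.

Variables (K : fieldType) (V : lmodType K) (A : {linear V -> V}).
Implicit Types (p q : {poly K}) (x y : V).

Lemma horner_op_widen (N : nat) p x : (size p <= N)%N ->
  horner_op p A x = \sum_(m < N) p`_m *: iter m A x.
Proof.
move=> leN; rewrite /horner_op.
rewrite (big_ord_widen _ (fun m => p`_m *: iter m A x) leN).
rewrite big_mkcond; apply: eq_bigr => m _; case: ltnP => // le_m.
by rewrite nth_default ?scale0r.
Qed.

Lemma iter_is_linear m a x y :
  iter m A (a *: x + y) = a *: iter m A x + iter m A y.
Proof. by elim: m => //= m ->; rewrite linearP. Qed.

Lemma horner_op_is_linear p a x y :
  horner_op p A (a *: x + y) = a *: horner_op p A x + horner_op p A y.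
Proof.
rewrite /horner_op scaler_sumr -big_split; apply: eq_bigr => m _ /=.
by rewrite iter_is_linear scalerDr !scalerA mulrC.
Qed.

HB.instance Definition _ p :=
  GRing.isLinear.Build K V V *:%R (horner_op p A) (horner_op_is_linear p).

Lemma horner_opDZl a p q x :
  horner_op (a *: p + q) A x = a *: horner_op p A x + horner_op q A x.
Proof.
pose N := maxn (size (a *: p + q)) (maxn (size p) (size q)).
rewrite !(@horner_op_widen N) ?leq_max ?leqnn ?orbT // scaler_sumr -big_split.
by apply: eq_bigr => m _; rewrite coefD coefZ scalerDl scalerA.
Qed.

(** The argument order under which linearity in the polynomial can be
    registered as a structure. *)
Definition horner_op_at x p := horner_op p A x.

HB.instance Definition _ x :=
  GRing.isLinear.Build K {poly K} V *:%R (horner_op_at x)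
    (fun a p q => horner_opDZl a p q x).

Lemma horner_op0 x : horner_op 0 A x = 0.
Proof. exact: (linear0 (horner_op_at x)). Qed.

Lemma horner_opD p q x :
  horner_op (p + q) A x = horner_op p A x + horner_op q A x.
Proof. exact: (linearD (horner_op_at x)). Qed.

Lemma horner_opB p q x :
  horner_op (p - q) A x = horner_op p A x - horner_op q A x.
Proof. exact: (linearB (horner_op_at x)). Qed.

Lemma horner_opZ a p x : horner_op (a *: p) A x = a *: horner_op p A x.
Proof. exact: (linearZ_LR (horner_op_at x)). Qed.

Lemma horner_op_sum (I : Type) (r : seq I) (P : pred I) (F : I -> {poly K}) x :
  horner_op (\sum_(i <- r | P i) F i) A x =
  \sum_(i <- r | P i) horner_op (F i) A x.
Proof. exact: (linear_sum (horner_op_at x)). Qed.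

Lemma horner_opXn m x : horner_op 'X^m A x = iter m A x.
Proof.
rewrite /horner_op size_polyXn big_ord_recr /= coefXn eqxx scale1r.
rewrite big1 ?add0r // => k _.
by rewrite coefXn ltn_eqF ?scale0r.
Qed.

Lemma horner_opC c x : horner_op c%:P A x = c *: x.
Proof.
rewrite -[c%:P]mulr1 mul_polyC -(expr0 'X).
by rewrite horner_opZ horner_opXn.
Qed.

Lemma horner_opMX p x : horner_op (p * 'X) A x = horner_op p A (A x).
Proof.
have le_sz : (size (p * 'X)%R <= (size p).+1)%N.
  by case: (eqVneq p 0) => [->|p0]; rewrite ?mul0r ?size_poly0 // size_mulX.
rewrite (horner_op_widen _ le_sz) big_ord_recl coefMX eqxx scale0r add0r.
by apply: eq_bigr => m _; rewrite coefMX /= -iterSr.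
Qed.

(** By induction on [q]: a factor ['X] of [q] can be moved to the right end of
    the product, where it acts first, as [A]. *)
Lemma horner_opM p q x :
  horner_op (p * q) A x = horner_op p A (horner_op q A x).
Proof.
rewrite [p * q]mulrC; elim/poly_ind: q x => [|q c IHq] x.
  by rewrite mul0r !horner_op0 linear0.
rewrite mulrDl mulrAC !horner_opD !horner_opMX IHq.
rewrite horner_opC mul_polyC horner_opZ.
by rewrite linearD linearZ.
Qed.

End HornerOp.

Lemma iter_map_mx (V : Type) (f : V -> V) (m p k : nat) (v : 'M[V]_(m, p))
    i j : iter k (map_mx f) v i j = iter k f (v i j).
Proof. by elim: k => //= k IHk; rewrite mxE IHk. Qed.

(** * Reduction of the system *)

(** Cramer's rule over the ring [{poly K}] acting on [V]: the system is
    multiplied on the left by the adjugate of the characteristic matrix. *)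
Lemma char_poly_op_solution (K : fieldType) (V : lmodType K)
    (A : {linear V -> V}) (n : nat) (B : 'M[K]_n) (phi x : 'cV[V]_n)
    (hx : forall i : 'I_n,
        A (x i 0) = \sum_(j < n) B i j *: x j 0 + phi i 0) (i : 'I_n) :
  horner_op (char_poly B) A (x i 0) =
  \sum_s horner_op (cofactor (char_poly_mx B) s i) A (phi s 0).
Proof.
have phiE s : phi s 0 = \sum_j horner_op (char_poly_mx B s j) A (x j 0).
  have entryE j : horner_op (char_poly_mx B s j) A (x j 0) =
      (if j == s then A (x j 0) else 0) - B s j *: x j 0.
    rewrite !mxE horner_opB horner_opC eq_sym; congr (_ - _).
    by case: (j == s); rewrite ?horner_op0 // -['X]/('X^1) horner_opXn.
  under eq_bigr => j _ do rewrite entryE.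
  by rewrite sumrB -big_mkcond big_pred1_eq hx addrC addKr.
under eq_bigr => s _ do rewrite phiE linear_sum /=.
rewrite exchange_big /=.
have adjE j : \sum_s horner_op (cofactor (char_poly_mx B) s i) A
      (horner_op (char_poly_mx B s j) A (x j 0)) =
    if j == i then horner_op (char_poly B) A (x j 0) else 0.
  under eq_bigr => s _ do rewrite -horner_opM.
  rewrite -horner_op_sum.
  have -> : \sum_s cofactor (char_poly_mx B) s i * char_poly_mx B s j =
            (char_poly B)%:M i j.
    rewrite -mul_adj_mx mxE; apply: eq_bigr => s _.
    by rewrite [(\adj _) i s]mxE.
  by rewrite mxE eq_sym; case: (j == i); rewrite ?horner_op0.
under eq_bigr => j _ do rewrite adjE.
by rewrite -big_mkcond big_pred1_eq.
Qed.

Theorem theorem4p3 (K : fieldType) (V : lmodType K) (A : {linear V -> V})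
    (n : nat) (B : 'M[K]_n) (phi : 'cV[V]_n) (x : 'cV[V]_n)
    (hx : forall i : 'I_n,
        A (x i 0) = \sum_(j < n) B i j *: x j 0 + phi i 0) :
  forall i : 'I_n,
    horner_op (char_poly B) A (x i 0) =
    \sum_(1 <= k < n.+1)
      (-1) ^+ k.-1 *: delta_minors_vec k i B (iter (n - k) (map_mx A) phi).
Proof.
move=> i; rewrite (char_poly_op_solution hx).
under [RHS]eq_bigr => k _ do rewrite delta_minors_vecE scaler_sumr.
rewrite exchange_big /=; apply: eq_bigr => s _.
rewrite cofactor_char_poly_mx horner_op_sum; apply: eq_bigr => k _.
by rewrite horner_opZ horner_opXn iter_map_mx scalerA.
Qed.
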